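(* The objects $[n]$ ($n\ge 0$), the morphisms $[m]\to[n]$ given by isomorphism classes of reduced boundary-labelled ordered forests from $[m]$ to $[n]$, the identities represented by $[n]\xrightarrow{\mathrm{id}}[n]\xleftarrow{\mathrm{id}}[n]$, and the composition $F\circ G=\mathrm{Red}(F\cdot G)$ form a well-defined category $\mathbf{OrdFor}$. Furthermore, for any objects $[m]$ and $[n]$, the hom-set $\mathrm{Hom}_{\mathbf{OrdFor}}([m],[n])$ is finite.
   Context: An ordered quiver is a triple $(P,\leq_P,\preceq_P)$ consisting of a finite set $P$, a partial order $\leq_P$ and a total order $\preceq_P$ on $P$ such that $x\leq_P y$ implies $x\preceq_P y$. Morphisms are set maps preserving both orders; the category is $\mathbf{Quiv}$. Put $L_P(x)=\{y\in P\mid y\leq_P x\}$. A subset $I$ of a poset is an interval if $a\leq c\leq b$ with $a,b\in I$ implies $c\in I$. An ordered forest is an ordered quiver such that $L_P(x)$ is an interval in $(P,\preceq_P)$ for every $x\in P$. The sets $\max(P)$, $\min(P)$ are the maximal and minimal elements for $\leq_P$. For $n\ge 0$, $[n]=\{0,\dots,n\}$ has its natural total order and the trivial (discrete) partial order. A boundary-labelled ordered forest from $[m]$ to $[n]$ is a cospan $[m]\xrightarrow{\iota^+}F\xleftarrow{\iota^-}[n]$ in $\mathbf{Quiv}$ with $F$ an ordered forest such that $\iota^+$ identifies $[m]$ with $\max(F)$ and $\iota^-$ identifies $[n]$ with $\min(F)$, both with the total orders induced by $\preceq_F$. Two such, $(F,\iota^\pm)$ and $(F',\jmath^\pm)$,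 are isomorphic if there is an isomorphism $\alpha:F\to F'$ in $\mathbf{Quiv}$ with $\alpha\iota^+=\jmath^+$ and $\alpha\iota^-=\jmath^-$. Raw graft. Given composable $[\ell]\xrightarrow{\iota_G^+} G\xleftarrow{\iota_G^-}[m]$ and $[m]\xrightarrow{\iota_F^+} F\xleftarrow{\iota_F^-}[n]$, for $i\in[m]$ write $x_i=\iota_F^+(i)$, $y_i=\iota_G^-(i)$, $F_i=L_F(x_i)$; the $F_i$ partition $F$ into $\preceq_F$-intervals. Let $H=F\cdot G:=(G\setminus\min(G))\sqcup F$ as a set. Let $j_F:F\hookrightarrow H$ be the inclusion and $j_G:G\to H$ be given by $j_G(y_i)=x_i$ and $j_G(z)=z$ for $z\in G\setminus\min(G)$. Let $p:H\to G$ be $p(a)=y_i$ for $a\in F_i$ and $p(a)=a$ for $a\in G\setminus\min(G)$. Total order: $a\preceq_H b$ iff $p(a)\prec_G p(b)$, or $p(a)=p(b)=y_i$ for some $i$ and $a\preceq_F b$, or $p(a)=p(b)\in G\setminus\min(G)$ and $a=b$. Partial order: (i) for $a,b\in F_i$, $a\leq_H b$ iff $a\leq_F b$; (ii) for $a,b\in G\setminus\min(G)$, $a\leq_H b$ iff $a\leq_G b$; (iii) for $a\in F_i$, $b\in G\setminus\min(G)$, $a\leq_H b$ iff $y_i\leq_G b$; (iv) no other pairs are comparable. The boundary labels of $H$ are $j_G\iota_G^+:[\ell]\to H$ and $j_F\iota_F^-:[n]\to H$. Reduction. An internal vertex of an ordered forest $F$ is an element not in $\min(F)\cup\max(F)$.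 It is unary if it has exactly one immediate predecessor and exactly one immediate successor for $\leq_F$. $F$ is reduced if it has no unary internal vertices. $\mathrm{Red}(H)$ is the ordered forest obtained by iteratively contracting all unary internal vertices: if $v$ is a unary internal vertex with immediate predecessor $u$ and immediate successor $w$, remove $v$, replace the covering relations $u<_H v$ and $v<_H w$ by the single covering relation $u<_H w$, and keep the total order $\preceq_H$ on the remaining elements. The boundary labels are unchanged. *)

(* Defs.v *)
From mathcomp Require Import all_boot.

Set Implicit Arguments.
Unset Strict Implicit.
Unset Printing Implicit Defensive.

(* Orders, labels and the constructions on them are bare data on a finType; the
   axioms are separate predicates. That the constructions preserve the axioms is
   therefore something to prove, not part of the definitions. *)

(** ** Ordered quivers *)

Record quiver_data := QuiverData {
  carrier :> finType;
  ple : rel carrier;   (* the partial order *)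
  tle : rel carrier    (* the total order *)
}.

Arguments ple {q} x y.
Arguments tle {q} x y.

Definition ordered_quiver (P : quiver_data) : Prop :=
  [/\ [/\ reflexive (@ple P), antisymmetric (@ple P) & transitive (@ple P)],
      [/\ reflexive (@tle P), antisymmetric (@tle P), transitive (@tle P)
        & total (@tle P)]
    & forall x y : P, ple x y -> tle x y].

Definition quiver_mor (P Q : quiver_data) (f : P -> Q) : Prop :=
  (forall x y, ple x y -> ple (f x) (f y)) /\
  (forall x y, tle x y -> tle (f x) (f y)).

(* [n] = {0, ..., n} is 'I_n.+1; the object [n] is represented by n : nat. *)
Definition std_quiver (n : nat) : quiver_data :=
  @QuiverData 'I_n.+1 (fun i j => i == j) (fun i j => i <= j).

Section QuiverNotions.
Variable P : quiver_data.
Implicit Types x y : P.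

Definition plt x y : bool := (x != y) && ple x y.
Definition tlt x y : bool := (x != y) && tle x y.

Definition minimal x : bool := [forall y : P, ple y x ==> (y == x)].
Definition maximal x : bool := [forall y : P, ple x y ==> (y == x)].

Definition covers x y : bool :=
  plt x y && ~~ [exists z : P, plt x z && plt z y].

Definition down_set x : {set P} := [set y | ple y x].

Definition tle_interval (I : {set P}) : Prop :=
  forall a b c : P, a \in I -> b \in I -> tle a c -> tle c b -> c \in I.

Definition internal x : bool := ~~ minimal x && ~~ maximal x.

Definition unary_internal x : bool :=
  [&& internal x, #|[set u | covers u x]| == 1
    & #|[set w | covers x w]| == 1].

End QuiverNotions.

Definition ordered_forest (P : quiver_data) : Prop :=
  ordered_quiver P /\ forall x : P, tle_interval (down_set x).

(** ** Boundary-labelled forests *)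

Record lquiver_data (m n : nat) := LQuiverData {
  underlying :> quiver_data;
  top : 'I_m.+1 -> underlying;
  bot : 'I_n.+1 -> underlying
}.

Arguments top {m n} l i.
Arguments bot {m n} l i.

Definition labelling (k : nat) (P : quiver_data) (S : pred P)
    (iota : 'I_k.+1 -> P) : Prop :=
  [/\ @quiver_mor (std_quiver k) P iota,
      injective iota,
      forall x : P, S x <-> exists i, iota i = x
    & forall i j : 'I_k.+1, tle (iota i) (iota j) = (i <= j)].

Definition labelled_forest (m n : nat) (F : lquiver_data m n) : Prop :=
  [/\ ordered_forest F, labelling (@maximal F) (top F)
    & labelling (@minimal F) (bot F)].

Definition reduced (m n : nat) (F : lquiver_data m n) : Prop :=
  forall v : F, ~~ unary_internal v.

Definition lquiver_iso (m n : nat) (F F' : lquiver_data m n) : Prop :=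
  exists (f : F -> F') (g : F' -> F),
    [/\ quiver_mor f /\ quiver_mor g, cancel f g /\ cancel g f,
        forall i, f (top F i) = top F' i
      & forall j, f (bot F j) = bot F' j].

Definition id_lquiver (n : nat) : lquiver_data n n :=
  @LQuiverData n n (std_quiver n) id id.

(** ** Raw graft *)

Section Graft.
Variables (l m n : nat) (F : lquiver_data m n) (G : lquiver_data l m).

Definition graft_carrier : finType := ({z : G | ~~ minimal z} + F)%type.

(* The index i with a \in F_i. When F is a labelled forest there is exactly one
   such i, so the default value and the choice made by [pick] are irrelevant. *)
Definition block (a : F) : 'I_m.+1 :=
  odflt ord0 [pick i | a \in down_set (top F i)].

Definition graft_proj (a : graft_carrier) : G :=
  match a with
  | inl z => val z
  | inr x => bot G (block x)
  end.

(* In the second branch z is minimal, hence z = bot G i for a unique i. *)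
Definition graft_inj_top (z : G) : graft_carrier :=
  match insub z : option {z : G | ~~ minimal z} with
  | Some z' => inl z'
  | None => inr (top F (odflt ord0 [pick i | bot G i == z]))
  end.

Definition graft_tle : rel graft_carrier := fun a b =>
  tlt (graft_proj a) (graft_proj b) ||
  (graft_proj a == graft_proj b) &&
    match a, b with
    | inr x, inr y => tle x y
    | inl z, inl t => z == t
    | _, _ => false
    end.

Definition graft_ple : rel graft_carrier := fun a b =>
  match a, b with
  | inr x, inr y => (block x == block y) && ple x y
  | inl z, inl t => ple (val z) (val t)
  | inr x, inl t => ple (bot G (block x)) (val t)
  | inl _, inr _ => false
  end.

Definition graft : lquiver_data l n :=
  @LQuiverData l n (@QuiverData graft_carrier graft_ple graft_tle)
    (fun i => graft_inj_top (top G i)) (fun j => inr (bot F j)).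

End Graft.

(** ** Reduction *)

Section Contract.
Variables (m n : nat) (H : lquiver_data m n) (u v w : H).
Hypotheses (top_neq : forall i, top H i != v) (bot_neq : forall j, bot H j != v).

Definition contract_carrier : finType := {x : H | x != v}.

(* The covering relations avoiding v, together with u < w. *)
Definition contract_cover : rel contract_carrier := fun a b =>
  covers (val a) (val b) || (val a == u) && (val b == w).

(* [connect] is the reflexive transitive closure. *)
Definition contract : lquiver_data m n :=
  @LQuiverData m n
    (@QuiverData contract_carrier (connect contract_cover)
       (fun a b => tle (val a) (val b)))
    (fun i => exist _ (top H i) (top_neq i))
    (fun j => exist _ (bot H j) (bot_neq j)).

End Contract.

(* The hypotheses on the labels hold automatically when H is a labelled forest:
   its labels are extremal, whereas v is internal. *)
Inductive contracts_to (m n : nat) (H : lquiver_data m n) :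
    lquiver_data m n -> Prop :=
| contracts_done : contracts_to H H
| contracts_step (u v w : H) (top_neq : forall i, top H i != v)
    (bot_neq : forall j, bot H j != v) (K : lquiver_data m n) :
    unary_internal v -> covers u v -> covers v w ->
    contracts_to (contract u w top_neq bot_neq) K ->
    contracts_to H K.

(* R is a result of contracting unary internal vertices of H, in some order,
   until none is left. *)
Definition is_Red (m n : nat) (H R : lquiver_data m n) : Prop :=
  contracts_to H R /\ reduced R.

(** ** The category *)

Record rforest (m n : nat) := RForest {
  rforest_data :> lquiver_data m n;
  rforest_forest : labelled_forest rforest_data;
  rforest_reduced : reduced rforest_data
}.

(* A morphism is an isomorphism class, as a set of reduced forests. *)
Record Hom (m n : nat) := MkHom {
  hom_class : rforest m n -> Prop;
  hom_classP : exists F : rforest m n,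
    hom_class = (fun F' : rforest m n => lquiver_iso F F')
}.

Definition iso_class (m n : nat) (F : rforest m n) : Hom m n :=
  MkHom (ex_intro _ F (erefl (fun F' : rforest m n => lquiver_iso F F'))).

Record is_category (Ob : Type) (Mor : Ob -> Ob -> Type)
    (idm : forall a, Mor a a)
    (comp : forall a b c, Mor b c -> Mor a b -> Mor a c) : Prop := IsCategory {
  cat_idl : forall a b (f : Mor a b), comp a b b (idm b) f = f;
  cat_idr : forall a b (f : Mor a b), comp a a b f (idm a) = f;
  cat_assoc : forall a b c d (h : Mor c d) (g : Mor b c) (f : Mor a b),
    comp a c d h (comp a b c g f) = comp a b d (comp b c d h g) f
}.

Definition finite_type (T : Type) : Prop :=
  exists (k : nat) (f : 'I_k -> T), bijective f.

(* Main.v *)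
(* Send each vertex x of a labelled forest to the set of labels of the minimal
   elements below x, and let the code of the forest consist of the family of
   the sets of its nonmaximal vertices together with the function sending i to
   the set of the i-th maximal vertex. Contracting a unary internal vertex
   does not change the code, since such a vertex has the same set as its
   predecessor. A reduced forest is determined by its code up to isomorphism:
   two distinct nonmaximal vertices have distinct sets, inclusion of sets
   recovers the partial order, and vertices incomparable for the partial order
   are totally ordered as the leaves below them. Finally the code of a graft is
   given by a formula in the codes of its factors which is strictly associative
   and unital. So morphisms embed into a finite set of codes, where all the
   category laws can be checked. *)

Require Import Defs.
From mathcomp Require Import all_boot.
From mathcomp Require Import boolp.

Set Implicit Arguments.
Unset Strict Implicit.
Unset Printing Implicit Defensive.

(** * Finite ordered quivers: covers and extremal elements *)

Section QuiverTheory.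
Variable P : quiver_data.
Hypothesis qP : ordered_quiver P.
Implicit Types x y z : P.

Lemma ple_refl : reflexive (@ple P). Proof. by case: qP => -[]. Qed.
Lemma ple_anti : antisymmetric (@ple P). Proof. by case: qP => -[]. Qed.
Lemma ple_trans : transitive (@ple P). Proof. by case: qP => -[]. Qed.
Lemma tle_refl : reflexive (@tle P). Proof. by case: qP => _ []. Qed.
Lemma tle_anti : antisymmetric (@tle P). Proof. by case: qP => _ []. Qed.
Lemma tle_trans : transitive (@tle P). Proof. by case: qP => _ []. Qed.
Lemma tle_total : total (@tle P). Proof. by case: qP => _ []. Qed.
Lemma ple_tle x y : ple x y -> tle x y. Proof. by case: qP => _ _; apply. Qed.

Lemma maximal_eq x y : maximal x -> ple x y -> y = x.
Proof. by move=> /forallP /(_ y) /implyP h /h /eqP. Qed.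

Lemma minimal_eq x y : minimal x -> ple y x -> y = x.
Proof. by move=> /forallP /(_ y) /implyP h /h /eqP. Qed.

Lemma plt_trans x y z : plt x y -> plt y z -> plt x z.
Proof.
move=> /andP[nxy xy] /andP[nyz yz]; apply/andP; split; last exact: ple_trans yz.
apply: contra nxy => /eqP exz; rewrite -exz in yz.
by apply/eqP/ple_anti; rewrite xy yz.
Qed.

Lemma plt_nmaximal x y : plt x y -> ~~ maximal x.
Proof. by move=> /andP[nxy xy]; apply: contra nxy => /maximal_eq/(_ xy) ->. Qed.

Lemma plt_nminimal x y : plt x y -> ~~ minimal y.
Proof. by move=> /andP[nxy xy]; apply: contra nxy => /minimal_eq/(_ xy) ->. Qed.

Lemma nmaximal_plt x : ~~ maximal x -> exists y, plt x y.
Proof.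
by case/forallPn=> y; rewrite negb_imply eq_sym => /andP[? ?]; exists y; apply/andP.
Qed.

Lemma nminimal_plt x : ~~ minimal x -> exists y, plt y x.
Proof.
by case/forallPn=> y; rewrite negb_imply => /andP[? ?]; exists y; apply/andP.
Qed.

(** The size of the down-set is a strictly increasing rank: extremal choices and inductions along
    the partial order are all made on it. *)
Lemma card_down_set x y : plt x y -> #|down_set x| < #|down_set y|.
Proof.
move=> /andP[nxy xy]; apply/proper_card/properP; split.
  by apply/subsetP=> z; rewrite !inE => /ple_trans; apply.
exists y; rewrite !inE ?ple_refl //; apply: contra nxy => yx.
by apply/eqP/ple_anti; rewrite xy yx.
Qed.

Lemma ex_cover_above x y : plt x y -> exists2 z, covers x z & ple z y.
Proof.
move=> xy.
have pxy : plt x y && ple y y by rewrite xy ple_refl.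
case: (@arg_minnP _ y (fun z => plt x z && ple z y) (fun z => #|down_set z|) pxy).
move=> z /andP[xz zy] zmin; exists z => //; rewrite /covers xz /=.
apply/existsP=> -[t /andP[xt tz]]; have := card_down_set tz; rewrite ltnNge zmin //.
by rewrite xt; case/andP: tz => _ /ple_trans; apply.
Qed.

Lemma ex_cover_below x y : plt x y -> exists2 z, covers z y & ple x z.
Proof.
move=> xy.
have pxy : plt x y && ple x x by rewrite xy ple_refl.
case: (@arg_maxnP _ x (fun z => plt z y && ple x z) (fun z => #|down_set z|) pxy).
move=> z /andP[zy xz] zmax; exists z => //; rewrite /covers zy /=.
apply/existsP=> -[t /andP[zt ty]]; have := card_down_set zt; rewrite ltnNge.
case/negP; apply: zmax; rewrite ty; case/andP: zt => _; exact: ple_trans.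
Qed.

Lemma ex_maximal_above x : exists2 y, maximal y & ple x y.
Proof.
case: (@arg_maxnP _ x (ple x) (fun z => #|down_set z|) (ple_refl x)) => y xy ymax.
exists y => //; apply: contraT => /nmaximal_plt[z yz].
have := card_down_set yz; rewrite ltnNge; case/negP; apply: ymax.
by case/andP: yz => _; apply: ple_trans.
Qed.

Lemma ex_minimal_below x : exists2 y, minimal y & ple y x.
Proof.
case: (@arg_minnP _ x (ple^~ x) (fun z => #|down_set z|) (ple_refl x)) => y yx ymin.
exists y => //; apply: contraT => /nminimal_plt[z zy].
have := card_down_set zy; rewrite ltnNge ymin //.
by case/andP: zy => _ /ple_trans; apply.
Qed.

(** The other two clauses are automatic: the source is discretely ordered, so monotonicity is
    reflexivity, and injectivity is antisymmetry of [<=] on indices. *)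
Lemma labelling_intro (k : nat) (S : pred P) (iota : 'I_k.+1 -> P) :
    (forall x, S x <-> exists i, iota i = x) ->
    (forall i j, tle (iota i) (iota j) = (i <= j)) ->
  labelling S iota.
Proof.
move=> hS ht; split=> //.
- split=> [i j /eqP -> | i j]; first exact: ple_refl.
  by rewrite ht.
- move=> i j eij; apply/val_inj/anti_leq.
  by rewrite -!ht eij tle_refl.
Qed.

End QuiverTheory.

(** * Consequences of the interval condition *)

Section ForestTheory.
Variable P : quiver_data.
Hypothesis fP : ordered_forest P.
Implicit Types x y z : P.

Let qP : ordered_quiver P. Proof. by case: fP. Qed.

Lemma forest_down a c x : ple a x -> tle a c -> tle c x -> ple c x.
Proof.
case: fP => _ /(_ x) h ax ac cx.
by have := h a x c; rewrite !inE; apply=> //; apply: ple_refl.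
Qed.

(** Of two elements above [a], the [tle]-smaller one lies between [a] and the other, hence in the
    interval below the other. This is what makes the order a forest growing down from its maximal
    elements. *)
Lemma forest_up_chain a x y : ple a x -> ple a y -> ple x y || ple y x.
Proof.
wlog xy : x y / tle x y => [hw ax ay|ax ay].
  by case/orP: (tle_total qP x y) => h; [|rewrite orbC]; apply: hw.
by rewrite (forest_down ay _ xy) //; apply: ple_tle.
Qed.

(** Otherwise [b], [x], [y] would be in this [tle]-order with [b] below [y], and the interval
    condition would put [x] below [y]. *)
Lemma forest_tle_below x y a b :
  tle x y -> ~~ ple x y -> ple a x -> ple b y -> tle a b.
Proof.
move=> xy nxy ax bY; case/orP: (tle_total qP a b) => // ba.
case/negP: nxy; apply: forest_down bY _ xy.
exact: tle_trans (ple_tle qP ax).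
Qed.

Lemma forest_covers_inj x y z : covers x y -> covers x z -> y = z.
Proof.
case/andP=> xy /existsPn hy /andP[xz /existsPn hz].
have [//|nyz] := eqVneq y z.
have [_ pxy] := andP xy; have [_ pxz] := andP xz.
case/orP: (forest_up_chain pxy pxz) => h.
- by case/negP: (hz y); rewrite xy /plt nyz.
- by case/negP: (hy z); rewrite xz /plt eq_sym nyz.
Qed.

End ForestTheory.

(** * Leaf sets and blocks of a labelled forest *)

Section Leaves.
Variables (m n : nat) (F : lquiver_data m n).
Hypothesis lF : labelled_forest F.
Implicit Types x y z : F.

Definition leaves x : {set 'I_n.+1} := [set j | ple (bot F j) x].

Let fF : ordered_forest F. Proof. by case: lF. Qed.
Let qF : ordered_quiver F. Proof. by case: fF. Qed.

Lemma in_leaves x j : (j \in leaves x) = ple (bot F j) x.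
Proof. by rewrite inE. Qed.

Lemma top_inj : injective (top F). Proof. by case: lF => _ []. Qed.
Lemma bot_inj : injective (bot F). Proof. by case: lF => _ _ []. Qed.
Lemma tle_top i j : tle (top F i) (top F j) = (i <= j). Proof. by case: lF => _ []. Qed.
Lemma tle_bot i j : tle (bot F i) (bot F j) = (i <= j). Proof. by case: lF => _ _ []. Qed.

Lemma maximalP x : reflect (exists i, top F i = x) (maximal x).
Proof. by case: lF => _ [_ _ h _] _; apply: (iffP idP) => /h. Qed.

Lemma minimalP x : reflect (exists j, bot F j = x) (minimal x).
Proof. by case: lF => _ _ [_ _ h _]; apply: (iffP idP) => /h. Qed.

Lemma maximal_top i : maximal (top F i). Proof. by apply/maximalP; exists i. Qed.
Lemma minimal_bot j : minimal (bot F j). Proof. by apply/minimalP; exists j. Qed.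

Lemma leaves_bot j : leaves (bot F j) = [set j].
Proof.
apply/setP=> k; rewrite in_leaves inE; apply/idP/eqP=> [h|->]; last exact: ple_refl.
exact/bot_inj/minimal_eq/h/minimal_bot.
Qed.

Lemma ex_leaf x : exists j, j \in leaves x.
Proof.
have [y /minimalP[j <-] yx] := ex_minimal_below qF x.
by exists j; rewrite in_leaves.
Qed.

Lemma leaves_sub x y : ple x y -> leaves x \subset leaves y.
Proof.
by move=> xy; apply/subsetP=> j; rewrite !in_leaves => /(ple_trans qF); apply.
Qed.

Lemma ex_top x : exists i, ple x (top F i).
Proof. by have [y /maximalP[i <-] ?] := ex_maximal_above qF x; exists i. Qed.

(** If the sets agreed, [y] would be unary. A predecessor [u] of [y] above [x] has all the leaves of
    [y], so any other predecessor shares a leaf with [u], is comparable with it, and so equals it.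
    The successor is unique in any forest. *)
Lemma nonmaximal_same_leaves x y :
  reduced F -> ~~ maximal y -> plt x y -> leaves x <> leaves y.
Proof.
move=> rF my xy el; have /negP[] := rF y.
have [u uy xu] := ex_cover_below qF xy.
have lu : leaves u = leaves y.
  apply/eqP; rewrite eqEsubset leaves_sub; last by case/andP: uy => /andP[].
  by rewrite -el leaves_sub.
have [t /(ex_cover_above qF)[w yw _]] := nmaximal_plt my.
rewrite /unary_internal /internal (plt_nminimal xy) my /=; apply/andP; split.
- apply/cards1P; exists u; apply/setP=> v; rewrite !inE; apply/idP/eqP=> [vy|-> //].
  have [j jv] := ex_leaf v.
  have ju : j \in leaves u.
    by rewrite lu; apply: subsetP jv; apply: leaves_sub; case/andP: vy => /andP[].
  rewrite !in_leaves in ju jv.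
  have [//|nvu] := eqVneq v u.
  case/orP: (forest_up_chain fF ju jv) => h.
  + case/andP: uy => _ /existsPn /(_ v); case/andP: vy => -> _.
    by rewrite /plt eq_sym nvu h.
  + case/andP: vy => _ /existsPn /(_ u); case/andP: uy => -> _.
    by rewrite /plt nvu h.
- apply/cards1P; exists w; apply/setP=> v; rewrite !inE; apply/idP/eqP=> [yv|-> //].
  exact: forest_covers_inj yv yw.
Qed.

(** A common leaf makes [x] and [y] comparable; [y] strictly below [x] would give two vertices with
    equal leaf sets. *)
Lemma leaves_sub_ple x y :
  reduced F -> ~~ maximal x -> leaves x \subset leaves y -> ple x y.
Proof.
move=> rF mx sxy; have [j jx] := ex_leaf x; have jy := subsetP sxy j jx.
rewrite !in_leaves in jx jy.
case/orP: (forest_up_chain fF jx jy) => // yx.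
have [<-|nyx] := eqVneq y x; first exact: ple_refl.
case: (@nonmaximal_same_leaves y x) => //; first by rewrite /plt nyx.
by apply/eqP; rewrite eqEsubset sxy leaves_sub.
Qed.

(** The roots above [x] form a chain of maximal elements, so there is exactly one, and [pick] never
    falls back on its default. *)
Lemma blockP x i : (block x == i) = ple x (top F i).
Proof.
have uniq_i k k' : ple x (top F k) -> ple x (top F k') -> k = k'.
  move=> h h'; apply: top_inj.
  case/orP: (forest_up_chain fF h h') => /maximal_eq -> //; exact: maximal_top.
rewrite /block; case: pickP => /= [k|no].
  by rewrite inE => xk; apply/eqP/idP=> [<- //|]; apply: uniq_i.
by have [k] := ex_top x; have := no k; rewrite inE => ->.
Qed.

Lemma ple_block x : ple x (top F (block x)). Proof. by rewrite -blockP. Qed.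

Lemma block_ple x y : ple x y -> block x = block y.
Proof.
by move=> xy; apply/eqP; rewrite blockP; apply: ple_trans (ple_block y).
Qed.

Lemma block_top i : block (top F i) = i.
Proof. by apply/eqP; rewrite blockP ple_refl. Qed.

(** If the root of [y] came before the root of [x], it would lie in [tle] between [x] and the root
    of [x], hence below that root, which its maximality forbids. *)
Lemma block_tle x y : tle x y -> block x <= block y.
Proof.
move=> xy; rewrite leqNgt; apply/negP=> lt.
have h : ple (top F (block y)) (top F (block x)).
  apply: (forest_down fF) (ple_block x) _ _; last by rewrite tle_top ltnW.
  exact: tle_trans xy (ple_tle qF (ple_block y)).
have := maximal_eq (maximal_top (block y)) h => /top_inj e.
by rewrite e ltnn in lt.
Qed.

End Leaves.

(** * Codes, and recovering a reduced forest from its code *)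

Definition code (m n : nat) : finType :=
  ({set {set 'I_n.+1}} * {ffun 'I_m.+1 -> {set 'I_n.+1}})%type.

Definition code_of (m n : nat) (F : lquiver_data m n) : code m n :=
  ([set leaves x | x : F & ~~ maximal x], [ffun i => leaves (top F i)]).

Lemma code_nonmaximal (m n : nat) (F F' : lquiver_data m n) (x : F) :
  code_of F = code_of F' -> ~~ maximal x ->
  exists2 x' : F', ~~ maximal x' & leaves x' = leaves x.
Proof.
case=> eS _ mx.
have : leaves x \in [set leaves y | y : F' & ~~ maximal y].
  by rewrite -eS; apply/imsetP; exists x; rewrite ?inE.
by case/imsetP=> x'; rewrite inE => ? ->; exists x'.
Qed.

Lemma code_top (m n : nat) (F F' : lquiver_data m n) i :
  code_of F = code_of F' -> leaves (top F i) = leaves (top F' i).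
Proof. by case=> _ /ffunP /(_ i); rewrite !ffunE. Qed.

Section CodeIso.
Variables m n : nat.
Implicit Types F : lquiver_data m n.

(* For reduced forests with the same code this relation is the graph of an
   isomorphism; its definition is symmetric, so properties that it preserves it
   also reflects. *)
Definition matched F F' (x : F) (x' : F') : Prop :=
  (exists i, x = top F i /\ x' = top F' i) \/
  [/\ ~~ maximal x, ~~ maximal x' & leaves x = leaves x'].

Lemma matchedC F F' (x : F) (x' : F') : matched x x' -> matched x' x.
Proof. by case=> [[i []]|[]]; [left; exists i|right]. Qed.

Section Pair.
Variables F F' : lquiver_data m n.
Hypotheses (lF : labelled_forest F) (rF : reduced F).
Hypotheses (lF' : labelled_forest F') (rF' : reduced F').
Hypothesis eFF' : code_of F = code_of F'.

Let fF' : ordered_forest F'. Proof. by case: lF'. Qed.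
Let qF' : ordered_quiver F'. Proof. by case: fF'. Qed.
Let qF : ordered_quiver F. Proof. by case: lF => -[]. Qed.

Lemma ex_matched (x : F) : exists x' : F', matched x x'.
Proof.
have [/(maximalP lF)[i <-]|mx] := boolP (maximal x).
  by exists (top F' i); left; exists i.
by have [x' mx' lx'] := code_nonmaximal eFF' mx; exists x'; right.
Qed.

Lemma matched_leaves (x : F) (x' : F') : matched x x' -> leaves x = leaves x'.
Proof. by case=> [[i [-> ->]]|[]] //; apply: code_top. Qed.

Lemma matched_ple (x y : F) (x' y' : F') :
  matched x x' -> matched y y' -> ple x y -> ple x' y'.
Proof.
move=> xx' yy' xy; case: (xx') => [[i [ex ex']]|[mx mx' _]].
- have eyx : y = x by apply: maximal_eq xy; rewrite ex; apply: maximal_top.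
  case: yy' => [[k [ey ey']]|[my _ _]].
    have -> : y' = x'.
      by rewrite ey' ex'; congr top; apply: (top_inj lF); rewrite -ex -ey.
    exact: ple_refl.
  by rewrite eyx ex (maximal_top lF) in my.
- apply: (leaves_sub_ple lF') => //.
  by rewrite -(matched_leaves xx') -(matched_leaves yy') (leaves_sub lF).
Qed.

(** The delicate point is that a leaf may also be a root, and the code must detect this: [bot F j]
    is nonmaximal exactly when the singleton of [j] occurs among the sets of nonmaximal vertices. *)
Lemma matched_bot j : matched (bot F j) (bot F' j).
Proof.
have lj : leaves (bot F j) = leaves (bot F' j) by rewrite !leaves_bot.
have [mj|mj] := boolP (maximal (bot F j)); last first.
  have [x' mx' lx'] := code_nonmaximal eFF' mj; right; split=> //.
  apply: contra mx' => mj'; rewrite (maximal_eq mj' (y := x')) //.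
    by rewrite -in_leaves lx' leaves_bot // inE.
have [i ei] := maximalP lF _ mj; left; exists i; split=> //.
apply/esym/maximal_eq; last by rewrite -in_leaves -(code_top _ eFF') ei leaves_bot ?inE.
apply: contraT => mj'; have [x mx lx] := code_nonmaximal (esym eFF') mj'.
case/negP: mx; rewrite (maximal_eq mj (y := x)) //.
by rewrite -in_leaves lx leaves_bot ?inE.
Qed.

End Pair.

(** Comparable pairs are settled by [matched_ple], used in both directions. For incomparable pairs,
    opposite total orders would force leaves [j] and [k] to satisfy both [j <= k] and [k <= j]; the
    shared leaf would make [x] and [y] comparable. *)
Lemma matched_tle F F' (x y : F) (x' y' : F') :
    labelled_forest F -> reduced F -> labelled_forest F' -> reduced F' ->
    code_of F = code_of F' ->
  matched x x' -> matched y y' -> tle x y -> tle x' y'.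
Proof.
move=> lF rF lF' rF' e xx' yy' xy.
have [fF fF'] : ordered_forest F /\ ordered_forest F' by case: lF; case: lF'.
have [qF qF'] : ordered_quiver F /\ ordered_quiver F' by case: fF; case: fF'.
have [pxy|npxy] := boolP (ple x y).
  exact/(ple_tle qF')/(matched_ple lF lF' rF' e xx' yy' pxy).
case/orP: (tle_total qF' x' y') => // yx'.
have [pyx'|npyx'] := boolP (ple y' x').
  have pyx := matched_ple lF' lF rF (esym e) (matchedC yy') (matchedC xx') pyx'.
  case/negP: npxy; have -> : x = y; last exact: ple_refl.
  by apply: (tle_anti qF); rewrite xy (ple_tle qF).
have [j jx] := ex_leaf lF x; have [k ky] := ex_leaf lF y.
have jx' := jx; have ky' := ky.
rewrite (matched_leaves e xx') in_leaves in jx'.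
rewrite (matched_leaves e yy') in_leaves in ky'.
rewrite !in_leaves in jx ky.
have le1 := forest_tle_below fF xy npxy jx ky; rewrite tle_bot // in le1.
have le2 := forest_tle_below fF' yx' npyx' ky' jx'; rewrite tle_bot // in le2.
have ejk : j = k by apply/val_inj/anti_leq; rewrite le1.
case/negP: npxy; rewrite -ejk in ky.
have /orP[//|pyx] := forest_up_chain fF jx ky.
have -> : x = y; last exact: ple_refl.
by apply: (tle_anti qF); rewrite xy (ple_tle qF).
Qed.

Lemma code_iso F F' :
    labelled_forest F -> reduced F -> labelled_forest F' -> reduced F' ->
  code_of F = code_of F' -> lquiver_iso F F'.
Proof.
move=> lF rF lF' rF' e; have e' := esym e.
have [f fP] := choice (ex_matched lF e); have [g gP] := choice (ex_matched lF' e').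
(* Two matches of one vertex are each below the other, so antisymmetry makes [matched]
   single-valued. *)
have matched_inj (E E' : lquiver_data m n) (x : E) (y z : E') :
    labelled_forest E -> labelled_forest E' -> reduced E' ->
    code_of E = code_of E' -> matched x y -> matched x z -> y = z.
  move=> lE lE' rE' eE xy xz.
  have [[qE _] [qE' _]] : ordered_forest E /\ ordered_forest E' by case: lE; case: lE'.
  have h := matched_ple lE lE' rE' eE.
  by apply: (ple_anti qE'); rewrite (h _ _ _ _ xy xz) ?(h _ _ _ _ xz xy) // (ple_refl qE).
exists f, g; split.
- split; split=> x y.
  + exact: matched_ple (fP x) (fP y).
  + exact: matched_tle (fP x) (fP y).
  + exact: matched_ple (gP x) (gP y).
  + exact: matched_tle (gP x) (gP y).
- split=> x.
  + exact: matched_inj (gP (f x)) (matchedC (fP x)).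
  + exact: matched_inj (fP (g x)) (matchedC (gP x)).
- by move=> i; apply: matched_inj (fP _) _ => //; left; exists i.
- by move=> j; apply: matched_inj (fP _) (matched_bot lF lF' e j).
Qed.

Lemma iso_code F F' : lquiver_iso F F' -> code_of F = code_of F'.
Proof.
case=> f [g [[[fp _] [gp _]] [fK gK] ft fb]].
have ple_f x y : ple (f x) (f y) = ple x y.
  by apply/idP/idP=> [/gp|/fp //]; rewrite !fK.
have lf x : leaves (f x) = leaves x by apply/setP=> j; rewrite !in_leaves -fb ple_f.
have mf x : maximal (f x) = maximal x.
  apply/forallP/forallP=> h y; apply/implyP.
    by rewrite -ple_f => /(implyP (h _)); rewrite (can_eq fK).
  by rewrite -[y]gK ple_f => /(implyP (h _)); rewrite (can_eq fK).
congr pair; last by apply/ffunP=> i; rewrite !ffunE -ft lf.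
apply/setP=> A; apply/imsetP/imsetP=> -[x]; rewrite inE => mx ->.
  by exists (f x); rewrite ?inE ?mf ?lf.
by exists (g x); rewrite ?inE -?mf -?lf gK.
Qed.

End CodeIso.

(** * Contraction of a unary vertex, and reduction *)

Section ContractTheory.
Variables (m n : nat) (H : lquiver_data m n) (u v w : H).
Hypotheses (top_neq : forall i, top H i != v) (bot_neq : forall j, bot H j != v).
Hypotheses (lH : labelled_forest H) (uv : unary_internal v).
Hypotheses (cuv : covers u v) (cvw : covers v w).

Let fH : ordered_forest H. Proof. by case: lH. Qed.
Let qH : ordered_quiver H. Proof. by case: fH. Qed.
Let K := contract u w top_neq bot_neq.

Lemma unary_below x : covers x v -> x = u.
Proof.
case/and3P: uv => _ /cards1P[t et] _ xv.
have : x \in [set u | covers u v] by rewrite inE.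
have : u \in [set u | covers u v] by rewrite inE.
by rewrite et !inE => /eqP -> /eqP.
Qed.

Lemma plt_contract_above x : plt v x -> ple w x.
Proof. by move=> /(ex_cover_above qH)[z /(forest_covers_inj fH cvw) <-]. Qed.

Lemma plt_contract_below x : plt x v -> ple x u.
Proof. by move=> /(ex_cover_below qH)[z /unary_below ->]. Qed.

Let puv : plt u v. Proof. by case/andP: cuv. Qed.
Let pvw : plt v w. Proof. by case/andP: cvw. Qed.

(** The closure of the modified covers is just the order of [H] restricted to the remaining
    vertices. A chain of covers of [H] from [a] to [b] can meet [v] only by passing from [u] to [w],
    and the added cover replaces that detour. *)
Lemma ple_contract (a b : K) : ple a b = ple (val a) (val b).
Proof.
apply/idP/idP=> [/connectP[p]|].
- elim: p a => [|c p IH] a /=; first by move=> _ ->; apply: ple_refl.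
  case/andP=> ac cp bE; apply: ple_trans (IH c cp bE) => //.
  case/orP: ac => [/andP[/andP[] //]|/andP[/eqP -> /eqP ->]].
  by have /andP[] := plt_trans qH puv pvw.
- change (ple (val a) (val b) -> connect (@contract_cover _ _ H u v w) a b).
  (* The gap in rank between [a] and [b] decreases at each cover. *)
  have [k] := ubnP (#|down_set (val b)| - #|down_set (val a)|).
  elim: k a => // k IH a hk ab.
  have [/val_inj ->|nab] := eqVneq (val a) (val b); first exact: connect0.
  have step (c : K) : contract_cover u w a c -> plt (val a) (val c) ->
      ple (val c) (val b) -> connect (@contract_cover _ _ H u v w) a b.
    move=> ac pac cb; apply: connect_trans (connect1 ac) _; apply: IH cb.
    have h1 := card_down_set qH pac.
    have h2 : #|down_set (val a)| < #|down_set (val b)|.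
      by apply: card_down_set => //; rewrite /plt nab.
    by rewrite ltnS in hk; apply: leq_trans hk; apply: ltn_sub2l.
  have [z caz zb] : exists2 z, covers (val a) z & ple z (val b).
    by apply: ex_cover_above => //; rewrite /plt nab.
  have [ezv|nzv] := eqVneq z v.
  (* When the next cover is [v], the vertex [a] is its only predecessor [u], and the path jumps to
     [w], still below [b]. *)
  + rewrite ezv in caz zb; have ea := unary_below caz.
    have wb : ple w (val b).
      by apply: plt_contract_above; rewrite /plt zb eq_sym (valP b).
    have nwv : w != v by case/andP: pvw; rewrite eq_sym.
    have cc : contract_cover u w a (Sub w nwv).
      by apply/orP; right; rewrite SubK ea !eqxx.
    apply: (step (Sub w nwv)) => //.
    by rewrite SubK ea; apply: plt_trans pvw.
  + have cc : contract_cover u w a (Sub z nzv) by rewrite /contract_cover SubK caz.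
    apply: (step (Sub z nzv)) => //.
    by rewrite SubK; case/andP: caz.
Qed.

Lemma maximal_contract (a : K) : maximal a = maximal (val a).
Proof.
apply/idP/idP=> [ma|/forallP ma]; last first.
  by apply/forallP=> b; rewrite ple_contract; apply: ma.
apply: contraT => /nmaximal_plt[x ax].
have [y ay nyv] : exists2 y, plt (val a) y & y != v.
  have [exv|nxv] := eqVneq x v; last by exists x.
  exists w; last by case/andP: pvw; rewrite eq_sym.
  by rewrite exv in ax; apply: plt_trans pvw.
have /andP[nay pay] := ay; case/eqP: nay.
have := @maximal_eq K a (Sub y nyv) ma; rewrite ple_contract.
by move=> /(_ pay) <-.
Qed.

Lemma minimal_contract (a : K) : minimal a = minimal (val a).
Proof.
apply/idP/idP=> [ma|/forallP ma]; last first.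
  by apply/forallP=> b; rewrite ple_contract; apply: ma.
apply: contraT => /nminimal_plt[x xa].
have [y ya nyv] : exists2 y, plt y (val a) & y != v.
  have [exv|nxv] := eqVneq x v; last by exists x.
  exists u; last by case/andP: puv.
  by rewrite exv in xa; apply: plt_trans puv _.
have /andP[nya pya] := ya; case/eqP: nya.
have := @minimal_eq K a (Sub y nyv) ma; rewrite ple_contract.
by move=> /(_ pya) <-.
Qed.

Lemma contract_forest : labelled_forest K.
Proof.
have qK : ordered_quiver K.
  split; [split|split|].
  - by move=> a; rewrite ple_contract ple_refl.
  - by move=> a b; rewrite !ple_contract => /(ple_anti qH)/val_inj.
  - by move=> b a c; rewrite !ple_contract; apply: ple_trans.
  - by move=> a; apply: (tle_refl qH).
  - by move=> a b /(tle_anti qH)/val_inj.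
  - by move=> b a c; apply: (tle_trans qH).
  - by move=> a b; apply: (tle_total qH).
  - by move=> a b; rewrite ple_contract => /(ple_tle qH).
split.
- split=> // x a b c; rewrite !inE !ple_contract => ax bx ac cb.
  apply: (forest_down fH ax ac); exact: (tle_trans qH) cb (ple_tle qH bx).
- apply: labelling_intro => // [x|i j]; last exact: (tle_top lH).
  rewrite maximal_contract; split=> [/(maximalP lH)[i ei]|[i <-]].
    by exists i; apply: val_inj.
  exact: maximal_top.
- apply: labelling_intro => // [x|i j]; last exact: (tle_bot lH).
  rewrite minimal_contract; split=> [/(minimalP lH)[i ei]|[i <-]].
    by exists i; apply: val_inj.
  exact: minimal_bot.
Qed.

Lemma leaves_contract (a : K) : leaves a = leaves (val a).
Proof. by apply/setP=> j; rewrite !in_leaves ple_contract. Qed.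

(** The set of the removed vertex stays in the family, since [u] is nonmaximal and has the same
    leaves as [v]. *)
Lemma code_contract : code_of K = code_of H.
Proof.
congr pair; last by apply/ffunP=> i; rewrite !ffunE leaves_contract.
apply/setP=> A; apply/imsetP/imsetP=> -[x]; rewrite inE => mx ->.
  by exists (val x); rewrite ?inE -?maximal_contract ?leaves_contract.
have lvu : leaves v = leaves u.
  apply/eqP; rewrite eqEsubset (leaves_sub lH (x := u)) ?andbT; last by case/andP: puv.
  apply/subsetP=> j; rewrite !in_leaves => jv.
  by apply: plt_contract_below; rewrite /plt jv bot_neq.
have [y [my nyv ->]] : exists y : H, [/\ ~~ maximal y, y != v & leaves x = leaves y].
  have [->|nxv] := eqVneq x v; last by exists x.
  by exists u; split=> //; [apply: plt_nmaximal puv|case/andP: puv].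
by exists (Sub y nyv : K); rewrite ?inE ?maximal_contract ?leaves_contract.
Qed.

Lemma card_contract : #|K| < #|H|.
Proof.
by rewrite card_sig (cardC1 v) ltn_predL; apply/card_gt0P; exists v.
Qed.

End ContractTheory.
(** This takes the place of a confluence argument: whatever the order of contractions, all results
    have the code of [H], so the reduced ones are isomorphic by [code_iso]. *)
Lemma contracts_forest_code (m n : nat) (H K : lquiver_data m n) :
    contracts_to H K -> labelled_forest H ->
  labelled_forest K /\ code_of K = code_of H.
Proof.
elim=> {H K} [H lH|H u v w tn bn K uv cuv cvw _ IH lH]; first by split.
have [lK ->] := IH (contract_forest tn bn lH uv cuv cvw).
by split=> //; apply: code_contract.
Qed.

Lemma ex_Red (m n : nat) (H : lquiver_data m n) :
  labelled_forest H -> exists R, is_Red H R.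
Proof.
have [k] := ubnP #|H|; elim: k H => // k IH H hk lH.
case: (pickP (@unary_internal H)) => [v uv|rH]; last first.
  by exists H; split; [apply: contracts_done|move=> v; rewrite rH].
have [/andP[nminv nmaxv] /cards1P[u eu] /cards1P[w ew]] := and3P uv.
have cuv : covers u v.
  by have := set11 u; rewrite -eu inE.
have cvw : covers v w.
  by have := set11 w; rewrite -ew inE.
have tn i : top H i != v by apply: contra nmaxv => /eqP <-; apply: maximal_top.
have bn j : bot H j != v by apply: contra nminv => /eqP <-; apply: minimal_bot.
have [||R [HR rR]] := IH (contract u w tn bn).
- by apply: leq_trans (card_contract _ _ _ _) _.
- exact: contract_forest.
by exists R; split=> //; apply: contracts_step HR.
Qed.

(** * The raw graft is a labelled forest; its code *)

Section GraftTheory.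
Variables (l m n : nat) (F : lquiver_data m n) (G : lquiver_data l m).
Hypotheses (lF : labelled_forest F) (lG : labelled_forest G).
Implicit Types (x y : F) (z t : G).

Let fF : ordered_forest F. Proof. by case: lF. Qed.
Let qF : ordered_quiver F. Proof. by case: fF. Qed.
Let fG : ordered_forest G. Proof. by case: lG. Qed.
Let qG : ordered_quiver G. Proof. by case: fG. Qed.

Let H := graft F G.
Implicit Types a b c : H.

Let proj (a : H) : G := graft_proj a.
Let inj_top (z : G) : H := graft_inj_top F z.

Lemma ple_graft_inl a (t : {z : G | ~~ minimal z}) :
  @ple H a (inl t) = ple (proj a) (val t).
Proof. by case: a. Qed.

Lemma ple_graft_inr x y : @ple H (inr x) (inr y) = ple x y.
Proof.
rewrite /= ; apply/andP/idP=> [[] //|xy]; split=> //.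
by rewrite (block_ple lF xy).
Qed.

Lemma ple_proj a b : ple a b -> ple (proj a) (proj b).
Proof.
case: a b => [a|x] [b|y] //; rewrite ple_graft_inr => /(block_ple lF) exy.
by rewrite /proj /= exy ple_refl.
Qed.

Lemma bot_neq_inl x (t : {z : G | ~~ minimal z}) : bot G (block x) != val t.
Proof. by apply: contra (valP t) => /eqP <-; apply: minimal_bot. Qed.

Lemma tle_proj a b : tle a b -> tle (proj a) (proj b).
Proof.
case/orP=> [/andP[] //|/andP[/eqP e _]].
by rewrite /proj e tle_refl.
Qed.

(** By [block_tle] the blocks follow one another in [F] in the order of their indices, so comparing
    blocks first does not alter the order of [F]. *)
Lemma tle_graft_inr x y : @tle H (inr x) (inr y) = tle x y.
Proof.
apply/idP/idP=> [|xy].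
- case/orP=> [/andP[/= nb tb]|/andP[_ //]].
  rewrite tle_bot // in tb.
  case/orP: (tle_total qF x y) => // /(block_tle lF) h.
  by case/eqP: nb; congr bot; apply/val_inj/anti_leq; rewrite tb.
- have := block_tle lF xy; rewrite -(tle_bot lG) => tb.
  apply/orP; rewrite /tlt /= tb xy /= !andbT.
  by case: eqVneq => _; [right|left].
Qed.

Lemma tle_graft_diff a b : proj a != proj b -> tle a b = tle (proj a) (proj b).
Proof.
move=> ne; apply/idP/idP=> [/tle_proj //|h].
by apply/orP; left; rewrite /tlt ne.
Qed.

Lemma tle_graft_inl (z t : {z : G | ~~ minimal z}) :
  @tle H (inl z) (inl t) = tle (val z) (val t).
Proof.
have [->|ne] := eqVneq z t; last by rewrite tle_graft_diff.
by rewrite (tle_refl qG) /= /graft_tle !eqxx orbT.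
Qed.

Lemma tle_graft_anti : antisymmetric (@tle H).
Proof.
move=> a b /andP[ab ba].
have e : proj a = proj b by apply: (tle_anti qG); rewrite !tle_proj.
case: a b ab ba e => [z|x] [t|y] ab ba e.
- by congr inl; apply: val_inj.
- by case/eqP: (bot_neq_inl y z).
- by case/eqP: (bot_neq_inl x t).
- by congr inr; apply: (tle_anti qF); rewrite -!tle_graft_inr ab ba.
Qed.

(** If the ends project differently, the comparison takes place in [G]. Otherwise all three
    projections coincide, and the mixed cases vanish because a vertex of [F] projects to a minimal
    element while a vertex kept from [G] does not. *)
Lemma tle_graft_trans : transitive (@tle H).
Proof.
move=> b a c ab bc; have tab := tle_proj ab; have tbc := tle_proj bc.
have tac := tle_trans qG tab tbc.
have [e|ne] := eqVneq (proj a) (proj c); last by rewrite tle_graft_diff.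
have e' : proj b = proj c by apply: (tle_anti qG); rewrite tbc -e tab.
case: a b c {tab tbc tac} ab bc e e' => [a|a] [b|b] [c|c] ab bc e e'.
- by rewrite tle_graft_inl [val a]e tle_refl.
- by case/eqP: (bot_neq_inl c a).
- by case/eqP: (bot_neq_inl b c).
- by case/eqP: (bot_neq_inl c a).
- by case/eqP: (bot_neq_inl a c).
- by case/eqP: (bot_neq_inl c b).
- by case/eqP: (bot_neq_inl a c).
- by move: ab bc; rewrite !tle_graft_inr; apply: (tle_trans qF).
Qed.

Lemma graft_quiver : ordered_quiver H.
Proof.
split; [split|split|].
- by case=> a; rewrite ?ple_graft_inr /= ple_refl.
- move=> a b /andP[ab ba]; have pab := ple_proj ab; have pba := ple_proj ba.
  case: a b ab ba pab pba => [z|x] [t|y] // ab ba pab pba.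
    by congr inl; apply/val_inj/(ple_anti qG); rewrite [ple _ _]pab.
  by congr inr; apply: (ple_anti qF); rewrite -!ple_graft_inr ab ba.
- move=> b a [c|c] ab bc.
    by rewrite !ple_graft_inl in bc *; apply: ple_trans bc => //; apply: ple_proj.
  case: b a bc ab => [b|b] // [a|a] //.
  by rewrite !ple_graft_inr => bc ab; apply: ple_trans bc.
- by case=> a; rewrite ?tle_graft_inr ?tle_graft_inl tle_refl.
- exact: tle_graft_anti.
- exact: tle_graft_trans.
- move=> a b; have [e|ne] := eqVneq (proj a) (proj b); last first.
    by rewrite !tle_graft_diff // 1?eq_sym //; apply: tle_total.
  case: a b e => [z|x] [t|y] e.
  + by rewrite !tle_graft_inl; apply: tle_total.
  + by case/eqP: (bot_neq_inl y z).
  + by case/eqP: (bot_neq_inl x t).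
  + by rewrite !tle_graft_inr; apply: tle_total.
- move=> a [t|y] ab.
    rewrite ple_graft_inl in ab; have tab := ple_tle qG ab.
    case: a ab tab => [z|x] ab tab; first by rewrite tle_graft_inl.
    by rewrite tle_graft_diff //; apply: bot_neq_inl.
  by case: a ab => // x; rewrite ple_graft_inr tle_graft_inr; apply: ple_tle.
Qed.

Lemma graft_ordered_forest : ordered_forest H.
Proof.
split; first exact: graft_quiver.
move=> d a b c; rewrite !inE => ad bd ac cb.
have {cb bd} cd : tle c d := tle_graft_trans cb (ple_tle graft_quiver bd).
case: d ad cd => [t|y] ad cd.
  rewrite ple_graft_inl in ad; rewrite ple_graft_inl.
  exact (forest_down fG ad (tle_proj ac) (tle_proj cd)).
case: a ad ac => // x; rewrite ple_graft_inr => xy xc.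
(* Projections squeeze [c] into the block of [y], so it comes from [F], where the interval condition
   applies. *)
have e : proj c = bot G (block y).
  apply: (tle_anti qG); rewrite (tle_proj cd).
  by have := tle_proj xc; rewrite /proj /= (block_ple lF xy).
case: c e xc cd => [z|c] e; first by case/eqP: (bot_neq_inl y z).
by rewrite !tle_graft_inr ple_graft_inr; apply: forest_down.
Qed.

Lemma inj_top_bot i : inj_top (bot G i) = inr (top F i).
Proof.
rewrite /inj_top /graft_inj_top insubN ?minimal_bot //.
case: pickP => [k /eqP /(bot_inj lG) -> //|/(_ i)].
by rewrite eqxx.
Qed.

Lemma inj_top_val (z : {z : G | ~~ minimal z}) : inj_top (val z) = inl z.
Proof. by rewrite /inj_top /graft_inj_top valK. Qed.

Lemma proj_inj_top z : proj (inj_top z) = z.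
Proof.
have [/(minimalP lG)[i <-]|mz] := boolP (minimal z).
  by rewrite inj_top_bot /proj /= block_top.
by rewrite -[z in inj_top z]/(val (Sub z mz : {z : G | ~~ minimal z})) inj_top_val.
Qed.

Lemma ple_inj_top_proj a : ple a (inj_top (proj a)).
Proof.
case: a => [z|x].
  by rewrite /proj [graft_proj _]/= inj_top_val (ple_refl graft_quiver).
by rewrite /proj [graft_proj _]/= inj_top_bot ple_graft_inr ple_block.
Qed.

(** A Galois connection: [inj_top] is right adjoint to [proj], and also a section of it by
    [proj_inj_top]. Maximality and leaves of vertices coming from [G] are computed through it. *)
Lemma ple_inj_top a z : ple a (inj_top z) = ple (proj a) z.
Proof.
have [/(minimalP lG)[i <-]|mz] := boolP (minimal z); last first.
  rewrite -[z in inj_top z]/(val (Sub z mz : {z : G | ~~ minimal z})).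
  by rewrite inj_top_val ple_graft_inl.
rewrite inj_top_bot; case: a => [t|x].
  apply/esym/negP=> /(minimal_eq (minimal_bot lG i)) e.
  by case/negP: (valP t); rewrite [val t]e minimal_bot.
rewrite ple_graft_inr -blockP // /proj /=; apply/eqP/idP=> [<-|]; first exact: ple_refl.
by move=> /(minimal_eq (minimal_bot lG i)) /(bot_inj lG).
Qed.

Lemma tle_inj_top z t : tle (inj_top z) (inj_top t) = tle z t.
Proof.
have [->|ne] := eqVneq z t; first by rewrite (tle_refl qG) (tle_refl graft_quiver).
by rewrite tle_graft_diff !proj_inj_top.
Qed.

Lemma maximal_graft_proj a : maximal a -> a = inj_top (proj a) /\ maximal (proj a).
Proof.
move=> ma; have ea := maximal_eq ma (ple_inj_top_proj a); split=> //.
apply/forallP=> z; apply/implyP=> az; apply/eqP.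
by rewrite -[LHS]proj_inj_top (maximal_eq ma (y := inj_top z)) // ple_inj_top.
Qed.

Lemma maximal_inj_top z : maximal (inj_top z) = maximal z.
Proof.
apply/idP/idP=> [/maximal_graft_proj[]|mz]; first by rewrite proj_inj_top.
apply/forallP=> a; apply/implyP=> za; apply/eqP/(ple_anti graft_quiver).
have := ple_proj za; rewrite proj_inj_top => /(maximal_eq mz) ea.
by rewrite za ple_inj_top ea ple_refl.
Qed.

Lemma minimal_graft_inr x : @minimal H (inr x) = minimal x.
Proof.
apply/forallP/forallP=> h y; apply/implyP.
  by move=> yx; have /implyP := h (inr y); rewrite ple_graft_inr => /(_ yx) /eqP[->].
case: y => // y; rewrite ple_graft_inr => /(implyP (h y)) /eqP ->.
by rewrite eqxx.
Qed.

Lemma nminimal_graft_inl (z : {z : G | ~~ minimal z}) : ~~ @minimal H (inl z).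
Proof.
have [t /(minimalP lG)[i <-] iz] := ex_minimal_below qG (val z).
apply/negP=> /(@minimal_eq H) h; have := h (inr (top F i)).
by rewrite ple_graft_inl /proj /= block_top // => /(_ iz).
Qed.

Lemma graft_forest : labelled_forest H.
Proof.
split; first exact: graft_ordered_forest.
- apply: labelling_intro; first exact: graft_quiver.
    move=> a; split=> [/maximal_graft_proj[ea /(maximalP lG)[i ei]]|[i <-]].
      by exists i; rewrite ea -ei.
    by rewrite [maximal _]maximal_inj_top maximal_top.
  by move=> i j; rewrite [LHS]tle_inj_top tle_top.
- apply: labelling_intro; first exact: graft_quiver.
    case=> [z|x]; split.
    + by rewrite (negPf (nminimal_graft_inl z)).
    + by case.
    + by rewrite minimal_graft_inr => /(minimalP lF)[j <-]; exists j.
    + by case=> j [<-]; rewrite minimal_graft_inr minimal_bot.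
  by move=> i j; rewrite [LHS]tle_graft_inr tle_bot.
Qed.

Lemma leaves_graft_inr x : leaves (inr x : H) = leaves x.
Proof. by apply/setP=> j; rewrite !in_leaves ple_graft_inr. Qed.

(** By the adjunction, a leaf of [F] lies below [inj_top z] iff the leaf of [G] indexed by its block
    lies below [z]. *)
Lemma leaves_inj_top z :
  leaves (inj_top z) = \bigcup_(i in leaves z) leaves (top F i).
Proof.
apply/setP=> j; rewrite in_leaves ple_inj_top /proj /=; apply/idP/bigcupP=> [h|[i]].
  by exists (block (bot F j)); rewrite in_leaves // ple_block.
by rewrite !in_leaves => iz; rewrite -blockP // => /eqP ->.
Qed.

End GraftTheory.

(* A nonmaximal vertex of a graft lies in the lower factor and is nonmaximal
   there, or comes from a nonmaximal vertex of the upper one, with the roots x_i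
   of the lower factor counted as the leaves y_i of the upper. *)
Definition code_comp (l m n : nat) (c : code m n) (d : code l m) : code l n :=
  (c.1 :|: [set \bigcup_(i in A) c.2 i | A : {set 'I_m.+1} in d.1],
   [ffun k => \bigcup_(i in d.2 k) c.2 i]).

Lemma code_graft (l m n : nat) (F : lquiver_data m n) (G : lquiver_data l m) :
    labelled_forest F -> labelled_forest G ->
  code_of (graft F G) = code_comp (code_of F) (code_of G).
Proof.
move=> lF lG.
have leavesE (z : G) : @leaves _ _ (graft F G) (graft_inj_top F z) =
    \bigcup_(i in leaves z) (code_of F).2 i.
  by rewrite leaves_inj_top //; apply: eq_bigr => i _; rewrite ffunE.
congr pair; last by apply/ffunP=> k; rewrite !ffunE [LHS]leavesE.
apply/setP=> A; apply/imsetP/setUP=> [[a]|].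
  rewrite inE => ma ->; case: a ma => [z|x] ma.
    right; apply/imsetP; exists (leaves (val z)).
      apply/imsetP; exists (val z) => //.
      by rewrite inE -(maximal_inj_top lF lG) (inj_top_val F).
    by rewrite -leavesE (inj_top_val F).
  (* A root of [F] can be nonmaximal in the graft; it is then the image of the leaf [bot G i] and is
     counted in the upper factor. *)
  have [/(maximalP lF)[i ei]|mx] := boolP (maximal x).
    right; apply/imsetP; exists (leaves (bot G i)).
      apply/imsetP; exists (bot G i) => //.
      by rewrite inE -(maximal_inj_top lF lG) (inj_top_bot _ lG) ei.
    by rewrite -leavesE (inj_top_bot _ lG) ei.
  left; apply/imsetP; exists x; rewrite ?inE //; exact: leaves_graft_inr.
case=> /imsetP[].
  move=> x; rewrite inE => mx ->; exists (inr x).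
    rewrite inE; have [y xy] := nmaximal_plt mx.
    apply: (@plt_nmaximal (graft F G) _ (inr y)); rewrite /plt (ple_graft_inr G lF).
    by case/andP: xy => nxy ->; rewrite andbT; apply: contra nxy => /eqP[->].
  by rewrite leaves_graft_inr.
move=> B /imsetP[z]; rewrite inE => mz -> ->.
by exists (graft_inj_top F z); rewrite ?inE ?maximal_inj_top ?leavesE.
Qed.

(** * Unit and associativity laws for codes *)

Definition code_id n : code n n := (set0, [ffun i => [set i]]).

Lemma code_comp_idl m n (c : code m n) : code_comp (code_id n) c = c.
Proof.
case: c => S r; rewrite /code_comp /= set0U.
have idE (A : {set 'I_n.+1}) :
    \bigcup_(i in A) [ffun i => [set i] : {set 'I_n.+1}] i = A.
  apply/setP=> j; apply/bigcupP/idP=> [[i iA]|jA]; first by rewrite ffunE inE => /eqP->.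
  by exists j; rewrite ?ffunE ?inE.
congr pair; last by apply/ffunP=> i; rewrite ffunE idE.
by rewrite (eq_imset _ (g := id)) ?imset_id // => A; apply: idE.
Qed.

Lemma code_comp_idr m n (c : code m n) : code_comp c (code_id m) = c.
Proof.
case: c => S r; rewrite /code_comp /= imset0 setU0.
by congr pair; apply/ffunP=> i; rewrite !ffunE big_set1.
Qed.

(** Both components come down to [bigcup_comp], associativity of Kleisli composition for the
    powerset monad. *)
Lemma code_compA k l m n (a : code m n) (b : code l m) (c : code k l) :
  code_comp a (code_comp b c) = code_comp (code_comp a b) c.
Proof.
have bigcup_comp (A : {set 'I_l.+1}) :
    \bigcup_(i in \bigcup_(j in A) b.2 j) a.2 i =
    \bigcup_(j in A) (code_comp a b).2 j.
  apply/setP=> x; apply/bigcupP/bigcupP=> [[i /bigcupP[j jA ij] xi]|[j jA]].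
    by exists j; rewrite // ffunE; apply/bigcupP; exists i.
  by rewrite ffunE => /bigcupP[i ij xi]; exists i => //; apply/bigcupP; exists j.
congr pair; last by apply/ffunP=> i; rewrite !ffunE bigcup_comp.
rewrite /= imsetU setUA -imset_comp; congr (_ :|: _).
by apply: eq_imset => A; apply: bigcup_comp.
Qed.

(** * Identity forests *)

Lemma id_forest n : labelled_forest (id_lquiver n).
Proof.
have qI : ordered_quiver (std_quiver n).
  split; [split|split|].
  - by move=> i; apply: eqxx.
  - by move=> i j /andP[/eqP].
  - by move=> j i k /eqP->.
  - by move=> i; apply: leqnn.
  - by move=> i j /anti_leq/val_inj.
  - by move=> j i k; apply: leq_trans.
  - by move=> i j; apply: leq_total.
  - by move=> i j /eqP->; apply: leqnn.
split.
- split=> // i a b c; rewrite !inE => /eqP-> /eqP-> ic ci.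
  by apply/eqP/val_inj/anti_leq/andP.
- apply: labelling_intro => // i; split=> _; first by exists i.
  by apply/forallP=> j; apply/implyP=> /eqP->.
- apply: labelling_intro => // i; split=> _; first by exists i.
  by apply/forallP=> j; apply/implyP=> /eqP->.
Qed.

Lemma maximal_id n (x : id_lquiver n) : maximal x.
Proof. by apply/forallP=> j; apply/implyP=> /eqP->. Qed.

Lemma id_reduced n : reduced (id_lquiver n).
Proof. by move=> v; rewrite /unary_internal /internal maximal_id andbF. Qed.

Lemma code_id_lquiver n : code_of (id_lquiver n) = code_id n.
Proof.
congr pair.
  by apply/setP=> A; rewrite !inE; apply/imsetP=> -[x]; rewrite inE maximal_id.
by apply/ffunP=> i; rewrite !ffunE; apply: (leaves_bot (id_forest n)).
Qed.

(** * Isomorphism classes as morphisms, and the category *)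

Lemma rforest_code_iso m n (F F' : rforest m n) :
  lquiver_iso F F' <-> code_of F = code_of F'.
Proof.
split; first exact: iso_code.
by case: F F' => [F lF rF] [F' lF' rF']; apply: code_iso.
Qed.

Lemma iso_class_eq m n (F F' : rforest m n) :
  code_of F = code_of F' <-> iso_class F = iso_class F'.
Proof.
split=> [e|].
- rewrite /iso_class; set p := ex_intro _ _ _; set p' := ex_intro _ _ _.
  have eC : (fun E : rforest m n => lquiver_iso F E) =
            (fun E : rforest m n => lquiver_iso F' E).
    by apply/funext => E; apply/propext; rewrite !rforest_code_iso e.
  (* The existence proofs mention the class, so they are generalised before rewriting and then
     identified by proof irrelevance. *)
  by move: p p'; rewrite eC => p p'; congr MkHom; apply: Prop_irrelevance.
- case=> /(congr1 (fun C => C F')) /= e; apply/rforest_code_iso.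
  by rewrite e; apply/rforest_code_iso.
Qed.

Lemma hom_rep m n (f : Hom m n) : exists F, iso_class F = f.
Proof.
case: f => C [F eC]; exists F; rewrite /iso_class; set p := ex_intro _ _ _.
move: (ex_intro _ F eC) => q; move: p; rewrite -eC => p.
by congr MkHom; apply: Prop_irrelevance.
Qed.

(** A representative is chosen classically; [hom_code_iso_class] shows that the value does not
    depend on it. *)
Definition hom_code m n (f : Hom m n) : code m n := code_of (projT1 (cid (hom_rep f))).

Lemma hom_code_iso_class m n (F : rforest m n) : hom_code (iso_class F) = code_of F.
Proof. by rewrite /hom_code; case: cid => F' /= /iso_class_eq. Qed.

Lemma hom_code_inj m n : injective (@hom_code m n).
Proof.
move=> f g; have [F <-] := hom_rep f; have [G <-] := hom_rep g.
by rewrite !hom_code_iso_class => /iso_class_eq.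
Qed.

Lemma Red_rforest m n (H R : lquiver_data m n) : labelled_forest H -> is_Red H R ->
  exists2 R' : rforest m n, rforest_data R' = R & code_of R' = code_of H.
Proof.
move=> lH [HR rR]; have [lR eR] := contracts_forest_code HR lH.
by exists (RForest lR rR).
Qed.

Lemma ex_hom_comp l m n (f : Hom m n) (g : Hom l m) :
  exists h : Hom l n, hom_code h = code_comp (hom_code f) (hom_code g).
Proof.
have [F <-] := hom_rep f; have [G <-] := hom_rep g.
have lFG := graft_forest (rforest_forest F) (rforest_forest G).
have [R /(Red_rforest lFG)[R' _ eR']] := ex_Red lFG.
exists (iso_class R'); rewrite !hom_code_iso_class eR'.
by apply: code_graft; apply: rforest_forest.
Qed.

(** By [hom_code_inj] the code pins down the composite, so the choice is forced. *)
Definition hom_comp l m n (f : Hom m n) (g : Hom l m) : Hom l n :=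
  projT1 (cid (ex_hom_comp f g)).

Lemma hom_code_comp l m n (f : Hom m n) (g : Hom l m) :
  hom_code (hom_comp f g) = code_comp (hom_code f) (hom_code g).
Proof. by rewrite /hom_comp; case: cid. Qed.

Definition id_rforest n : rforest n n := RForest (id_forest n) (@id_reduced n).

(** [T] is in bijection with the image of [f], a subset of [C] that can be enumerated once
    membership is decided classically. *)
Lemma inj_finite_type (T : Type) (C : finType) (f : T -> C) :
  injective f -> finite_type T.
Proof.
move=> f_inj; pose A := [set c : C | `[<exists t, f t = c>]].
have fA t : f t \in A by rewrite inE; apply/asboolP; exists t.
have hA (i : 'I_#|A|) : exists t, f t = enum_val i.
  by have := enum_valP i; rewrite inE => /asboolP.
have [g gP] := choice hA.
exists #|A|, g; exists (fun t => enum_rank_in (fA t) (f t)) => [i|t].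
  by apply: enum_val_inj; rewrite enum_rankK_in ?gP // enum_valP.
by apply: f_inj; rewrite gP enum_rankK_in.
Qed.

Theorem theorem2p14 :
  (exists (idm : forall n : nat, Hom n n)
          (comp : forall l m n : nat, Hom m n -> Hom l m -> Hom l n),
    [/\ (forall n : nat,
           exists2 I : rforest n n,
             rforest_data I = id_lquiver n & idm n = iso_class I),
        (forall (l m n : nat) (F : rforest m n) (G : rforest l m),
           [/\ labelled_forest (graft F G),
               (exists R : lquiver_data l n, is_Red (graft F G) R)
             & (forall R : lquiver_data l n, is_Red (graft F G) R ->
                  exists2 R' : rforest l n,
                    rforest_data R' = R &
                    comp l m n (iso_class F) (iso_class G) = iso_class R')])
      & is_category idm comp])
  /\ (forall m n : nat, finite_type (Hom m n)).
Proof.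
split; last by move=> m n; apply: inj_finite_type (@hom_code_inj m n).
exists (fun n => iso_class (id_rforest n)), hom_comp; split.
- by move=> n; exists (id_rforest n).
- move=> l m n F G.
  have lFG := graft_forest (rforest_forest F) (rforest_forest G).
  split=> // [|R /(Red_rforest lFG)[R' <- eR']]; first exact: ex_Red.
  (* Any reduction of the graft has the code of the graft, which is the composite of the two
     codes. *)
  exists R' => //; apply: hom_code_inj.
  rewrite hom_code_comp !hom_code_iso_class eR'.
  by rewrite code_graft //; apply: rforest_forest.
- have code_idm n : hom_code (iso_class (id_rforest n)) = code_id n.
    by rewrite hom_code_iso_class code_id_lquiver.
  split=> *; apply: hom_code_inj; rewrite !hom_code_comp ?code_idm.
  + exact: code_comp_idl.
  + exact: code_comp_idr.
  + exact: code_compA.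
Qed.
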